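(* For every finite simple graph $G$, the graph $G_1=G\times K_1$ is homotopic to $G$.
   Context: The unit sphere $S(x)$ of a vertex $x$ is the subgraph induced on the neighbors of $x$. Contractible (inductively): $K_1$ is contractible; a finite simple graph $G$ is contractible if there is a vertex $x$ such that both $S(x)$ and $G\setminus\{x\}$ (remove $x$ and its edges) are contractible. Homotopic: a homotopy step removes from a graph a vertex $x$ whose unit sphere $S(x)$ is contractible, or, in reverse, adds a new vertex joined exactly to the vertices of a contractible induced subgraph. Two finite simple graphs are homotopic if one can be obtained from the other (up to isomorphism) by finitely many homotopy steps. Refinement: $G\times K_1$ is (up to isomorphism) the graph whose vertices are the nonempty complete subgraphs (simplices) of $G$, two distinct ones being adjacent iff one is contained in the other. *)

(* Defs.v *)
From HB Require Import structures.
From Stdlib Require Import Relation_Operators.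
From mathcomp Require Import all_boot.
Set Implicit Arguments.
Unset Strict Implicit.
Unset Printing Implicit Defensive.

(* The empty graph is allowed; it is not contractible. *)
Record sgraph : Type := SGraph {
  vertex :> finType;
  adj : rel vertex;
  adj_sym : symmetric adj;
  adj_irr : irreflexive adj
}.

Definition isomorphic (G H : sgraph) : Prop :=
  exists f : G -> H, bijective f /\ (forall x y, adj (f x) (f y) = adj x y).

Section Constructions.
Variable G : sgraph.

Section Induced.
Variable A : {set G}.
Definition induced_adj : rel {x : G | x \in A} :=
  fun x y => adj (val x) (val y).
Lemma induced_sym : symmetric induced_adj.
Proof. by move=> x y; apply: adj_sym. Qed.
Lemma induced_irr : irreflexive induced_adj.
Proof. by move=> x; apply: adj_irr. Qed.
Definition induced : sgraph := SGraph induced_sym induced_irr.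

(* [None] is the new vertex, joined exactly to the vertices in [A]. *)
Definition add_adj : rel (option G) := fun u v =>
  match u, v with
  | Some x, Some y => adj x y
  | Some x, None | None, Some x => x \in A
  | None, None => false
  end.
Lemma add_sym : symmetric add_adj.
Proof. by case=> [x|] [y|] //=; apply: adj_sym. Qed.
Lemma add_irr : irreflexive add_adj.
Proof. by case=> [x|] //=; apply: adj_irr. Qed.
Definition add_vertex : sgraph := SGraph add_sym add_irr.
End Induced.

Definition unit_sphere (x : G) : sgraph := induced [set y | adj x y].

Definition del_vertex (x : G) : sgraph := induced [set~ x].

Definition complete_set (A : {set G}) : bool :=
  [forall x in A, forall y in A, (x != y) ==> adj x y].

Definition simplex : finType :=
  {A : {set G} | (A != set0) && complete_set A}.

Definition refinement_adj : rel simplex := fun s t =>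
  (s != t) && ((val s \subset val t) || (val t \subset val s)).
Lemma refinement_sym : symmetric refinement_adj.
Proof. by move=> s t; rewrite /refinement_adj eq_sym orbC. Qed.
Lemma refinement_irr : irreflexive refinement_adj.
Proof. by move=> s; rewrite /refinement_adj eqxx. Qed.
Definition refinement : sgraph := SGraph refinement_sym refinement_irr.

End Constructions.

(* A simple graph with exactly one vertex is a copy of K_1. *)
Inductive contractible (G : sgraph) : Prop :=
| contractible_K1 : #|G| = 1 -> contractible G
| contractible_ext (x : G) :
    contractible (unit_sphere x) -> contractible (del_vertex x) ->
    contractible G.

Inductive homotopy_step (G : sgraph) : sgraph -> Prop :=
| step_remove (x : G) :
    contractible (unit_sphere x) -> homotopy_step G (del_vertex x)
| step_add (A : {set G}) :
    contractible (induced A) -> homotopy_step G (add_vertex A).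

(* Removals and additions are inverse to each other up to isomorphism, so it
   does not matter which of the two graphs the steps start from. *)
Definition homotopic (G H : sgraph) : Prop :=
  exists2 K : sgraph, clos_refl_trans sgraph homotopy_step G K & isomorphic K H.

(* Main.v *)
(** Let M be the graph on the vertices and the simplices of G together, where
    a vertex v is joined to a simplex s iff v \in s.  Both G and its refinement
    are obtained from M by removing vertices with contractible unit spheres.

    Removing the simplices, larger ones first, leaves G: at its removal, the
    sphere of s consists of the vertices of s and of proper faces of s, and it
    is contractible because the same removals reduce it to a complete graph.

    Removing the vertices, in any order, leaves the refinement: at its removal,
    the sphere of v consists of the simplices containing v and of neighbours of
    v.  More generally, the simplices containing a simplex s together with any
    set of vertices in the link of s form a contractible graph: the sphere of
    such a vertex w in it is of the same form for w |: s, and once all these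
    vertices are removed, s is joined to everything else. *)

Require Import Defs.
From Stdlib Require Import Relation_Operators.
From mathcomp Require Import all_boot.
Set Implicit Arguments.
Unset Strict Implicit.
Unset Printing Implicit Defensive.

(** * Vertex sets of a fixed graph as stand-ins for induced subgraphs *)

Section Subgraphs.
Variable H : sgraph.
Implicit Types (A : {set H}) (K : sgraph).

Definition nbhd (x : H) : {set H} := [set y | adj x y].

(** Mirrors [contractible] inside the ambient graph [H], so that iterated spheres and deletions stay
    subsets of [H] instead of nested subtypes. *)
Inductive contractible_set A : Prop :=
| contractible_set1 : #|A| = 1 -> contractible_set A
| contractible_setD1 (x : H) : x \in A ->
    contractible_set (A :&: nbhd x) -> contractible_set (A :\ x) ->
    contractible_set A.

Definition represents K A : Prop :=
  exists f : K -> H,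
    [/\ injective f, forall x y, adj (f x) (f y) = adj x y & f @: setT = A].

Lemma represents_induced_imset K (f : K -> H) (B : {set K}) :
  injective f -> (forall x y, adj (f x) (f y) = adj x y) ->
  represents (induced B) (f @: B).
Proof.
move=> f_inj f_adj; exists (f \o val); split.
- by apply: inj_comp f_inj val_inj.
- by move=> x y /=; rewrite f_adj.
- apply/setP=> z; apply/imsetP/imsetP => [[x _ ->]|[x xB ->]].
    by exists (val x) => //; apply: valP.
  by exists (Sub x xB : {y | y \in B}).
Qed.

Lemma represents_induced A : represents (induced A) A.
Proof.
rewrite -[X in represents _ X]imset_id.
by apply: represents_induced_imset.
Qed.

Lemma represents_sphere K (f : K -> H) (x : K) :
  injective f -> (forall y z, adj (f y) (f z) = adj y z) ->
  represents (unit_sphere x) ((f @: setT) :&: nbhd (f x)).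
Proof.
move=> f_inj f_adj.
suff -> : (f @: setT) :&: nbhd (f x) = f @: [set y | adj x y].
  exact: represents_induced_imset.
apply/setP=> z; rewrite !inE; apply/andP/imsetP => [[/imsetP[y _ ->]]|[y]].
  by rewrite f_adj => xy; exists y; rewrite ?inE.
by rewrite inE => xy ->; rewrite f_adj imset_f.
Qed.

Lemma represents_del K (f : K -> H) (x : K) :
  injective f -> (forall y z, adj (f y) (f z) = adj y z) ->
  represents (del_vertex x) ((f @: setT) :\ f x).
Proof.
move=> f_inj f_adj.
suff -> : (f @: setT) :\ f x = f @: [set~ x].
  exact: represents_induced_imset.
apply/setP=> z; rewrite !inE; apply/andP/imsetP => [[zx /imsetP[y _ zy]]|[y]].
  by exists y; rewrite // !inE; apply: contraNneq zx => <-; rewrite zy.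
by rewrite !inE => yx ->; rewrite imset_f // (inj_eq f_inj).
Qed.

Lemma contractible_represents A K :
  contractible_set A -> represents K A -> contractible K.
Proof.
move=> cA; elim: cA K => {A} [A A1|A x xA _ IHs _ IHd] K [f [f_inj f_adj fA]].
  by apply: contractible_K1; rewrite -cardsT -(card_imset _ f_inj) fA.
move: xA; rewrite -fA => /imsetP[y _ xy].
apply: (contractible_ext (x := y)); [apply: IHs | apply: IHd].
  by rewrite -fA xy; apply: represents_sphere.
by rewrite -fA xy; apply: represents_del.
Qed.

(** Any [y] other than the apex [x] can be removed: its sphere in [A] and the rest [A :\ y] are
    smaller cones with the same apex. *)
Lemma contractible_cone A x :
  x \in A -> (forall y, y \in A -> y != x -> adj x y) -> contractible_set A.
Proof.
have [n] := ubnP #|A|; elim: n A => // n IHn A ltAn xA apex.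
have [A1|[y]] := set_0Vmem (A :\ x).
  by apply: contractible_set1; rewrite (cardsD1 x) xA A1 cards0.
rewrite !inE => /andP[yx yA].
have ltD : #|A :\ y| < n by rewrite (cardsD1 y) yA in ltAn.
apply: (contractible_setD1 yA); apply: IHn.
- apply: leq_ltn_trans ltD; apply/subset_leq_card/subsetP => z.
  rewrite !inE => /andP[-> yz]; rewrite andbT.
  by apply: contraTneq yz => ->; rewrite adj_irr.
- by rewrite !inE xA adj_sym apex.
- by move=> z; rewrite !inE => /andP[zA _]; apply: apex.
- exact: ltD.
- by rewrite !inE eq_sym yx.
- by move=> z; rewrite !inE => /andP[_ zA]; apply: apex.
Qed.

Lemma represents_isomorphic A K L :
  represents K A -> represents L A -> isomorphic K L.
Proof.
move=> [f [f_inj f_adj fA]] [g [g_inj g_adj gA]].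
have fg x : exists y, g y == f x.
  have : f x \in g @: setT by rewrite gA -fA imset_f.
  by case/imsetP=> y _ ->; exists y.
pose h x := xchoose (fg x).
have gh x : g (h x) = f x by apply/eqP/(xchooseP (fg x)).
exists h; split=> [|x y]; last by rewrite -g_adj !gh f_adj.
apply: inj_card_bij; first by move=> x y /(congr1 g); rewrite !gh => /f_inj.
by rewrite -!cardsT -(card_imset _ f_inj) -(card_imset _ g_inj) fA gA.
Qed.

(** Quantifying over every copy [K] of [A] lets deformations compose without transporting homotopy
    steps along isomorphisms. *)
Definition deforms A B : Prop := forall K, represents K A ->
  exists2 L, clos_refl_trans sgraph homotopy_step K L & represents L B.

Lemma deforms_refl A : deforms A A.
Proof. by move=> K rK; exists K => //; apply: rt_refl. Qed.

Lemma deforms_trans B A C : deforms A B -> deforms B C -> deforms A C.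
Proof.
move=> AB BC K /AB[L KL /BC[M LM rM]]; exists M => //.
exact: rt_trans KL LM.
Qed.

Lemma deforms_remove A x :
  x \in A -> contractible_set (A :&: nbhd x) -> deforms A (A :\ x).
Proof.
move=> xA cS K [f [f_inj f_adj fA]].
move: xA; rewrite -fA => /imsetP[y _ xy].
exists (del_vertex y); last by rewrite xy; apply: represents_del.
apply/rt_step/step_remove; apply: contractible_represents cS _.
by rewrite -fA xy; apply: represents_sphere.
Qed.

Lemma deforms_add A x :
  x \in A -> contractible_set (A :&: nbhd x) -> deforms (A :\ x) A.
Proof.
move=> xA cS K [f [f_inj f_adj fA]].
have fx y : f y != x.
  by have := imset_f f (in_setT y); rewrite fA !inE => /andP[].
pose B := [set y | adj x (f y)].
exists (add_vertex B).
  apply/rt_step/step_add; apply: contractible_represents cS _.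
  suff -> : A :&: nbhd x = f @: B by apply: represents_induced_imset.
  apply/setP=> z; rewrite !inE; apply/andP/imsetP => [[zA xz]|[y]].
    have : z \in f @: setT.
      by rewrite fA !inE zA andbT; apply: contraTneq xz => ->; rewrite adj_irr.
    by case/imsetP=> y _ zy; exists y; rewrite // inE -zy.
  rewrite inE => xy ->; split=> //.
  by have := imset_f f (in_setT y); rewrite fA !inE => /andP[].
(* The added vertex [None] plays the role of [x]. *)
exists (oapp f x); split.
- case=> [y|] [z|] //= => [/f_inj -> //|/eqP|/esym/eqP].
    by rewrite (negPf (fx _)).
  by rewrite (negPf (fx _)).
- by case=> [y|] [z|] /=; rewrite ?f_adj ?inE ?adj_irr // adj_sym.
- rewrite -(setD1K xA) -fA; apply/setP=> z; rewrite in_setU1.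
  apply/imsetP/predU1P => [[[y|] _ ->]|[->|/imsetP[y _ ->]]] /=.
  + by right; apply: imset_f.
  + by left.
  + by exists None.
  + by exists (Some y).
Qed.

End Subgraphs.

(** * The graph M on vertices and simplices *)

Section Mixed.
Variable G : sgraph.
Implicit Types (V W : {set G}) (F : {set simplex G}) (s t : simplex G).

(** Each summand keeps its own adjacency, so [G] and its refinement are induced subgraphs of M. *)
Definition mixed_adj : rel (G + simplex G) := fun a b =>
  match a, b with
  | inl v, inl w => adj v w
  | inr s, inr t => refinement_adj s t
  | inl v, inr s | inr s, inl v => v \in val s
  end.

Lemma mixed_sym : symmetric mixed_adj.
Proof.
by case=> [v|s] [w|t] //=; [apply: adj_sym | apply: refinement_sym].
Qed.

Lemma mixed_irr : irreflexive mixed_adj.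
Proof. by case=> [v|s] /=; [apply: adj_irr | apply: refinement_irr]. Qed.

Definition mixed : sgraph := SGraph mixed_sym mixed_irr.

Definition mixed_set V F : {set mixed} :=
  [set a : mixed | match a with inl v => v \in V | inr s => s \in F end].

Lemma mixed_setI_nbhdl V F (v : G) :
  mixed_set V F :&: @nbhd mixed (inl v) =
  mixed_set (V :&: [set w | adj v w]) [set t in F | v \in val t].
Proof. by apply/setP=> -[w|t]; rewrite !inE. Qed.

Lemma mixed_setI_nbhdr V F s :
  mixed_set V F :&: @nbhd mixed (inr s) =
  mixed_set (V :&: val s) [set t in F | refinement_adj s t].
Proof. by apply/setP=> -[w|t]; rewrite !inE. Qed.

Lemma mixed_setD1l V F (v : G) :
  mixed_set V F :\ (inl v : mixed) = mixed_set (V :\ v) F.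
Proof. by apply/setP=> -[w|t]; rewrite !inE. Qed.

Lemma mixed_setD1r V F s :
  mixed_set V F :\ (inr s : mixed) = mixed_set V (F :\ s).
Proof. by apply/setP=> -[w|t]; rewrite !inE. Qed.

Lemma simplex_adj s (v w : G) :
  v \in val s -> w \in val s -> v != w -> adj v w.
Proof.
case/andP: (valP s) => _ /forall_inP cs vs ws vw.
by have /forall_inP/(_ w ws)/implyP/(_ vw) := cs v vs.
Qed.

(** * Removing the simplices *)

Lemma largest_sphere V F s :
  (forall t, t \in F -> #|val t| <= #|val s|) ->
  mixed_set V F :&: @nbhd mixed (inr s) =
  mixed_set (V :&: val s) [set t in F :\ s | val t \subset val s].
Proof.
move=> s_max; rewrite mixed_setI_nbhdr; congr mixed_set.
apply/setP=> t; rewrite !inE /refinement_adj eq_sym.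
have [tF|_] := boolP (t \in F); last by rewrite andbF.
have [//|ts] := eqVneq t s; rewrite /= orbC.
have [//|/negP t_s] := boolP (val t \subset val s); apply/negP=> s_t.
(* By maximality of [s], a simplex of [F] containing [s] equals it; hence only faces of [s] are
   adjacent to it. *)
have /eqP st : val s == val t by rewrite eqEcard s_max // andbT.
by case/eqP: ts; apply: val_inj.
Qed.

Lemma exists_largest F : F != set0 ->
  exists2 s, s \in F & forall t, t \in F -> #|val t| <= #|val s|.
Proof.
case/set0Pn=> s0 s0F.
by case: (arg_maxnP (fun s => #|val s|) s0F) => s sF s_max; exists s.
Qed.

(** Remove a largest simplex [s] of [F]. Its sphere is a configuration of the same kind with [val s]
    in place of [W], and the deletion keeps [W]; both have fewer simplices. With none left, the
    complete graph on [W] is a cone. *)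
Lemma contractible_faces W F :
  W != set0 -> complete_set W -> (forall t, t \in F -> val t \subset W) ->
  contractible_set (mixed_set W F).
Proof.
have [n] := ubnP #|F|; elim: n W F => // n IHn W F ltFn W0 Wc FW.
have [F0|F0] := eqVneq F set0.
  have [v vW] := set0Pn _ W0.
  apply: (contractible_cone (x := inl v : mixed)); first by rewrite inE.
  case=> [w|t]; rewrite inE ?F0 ?inE //= => wW wv.
  have /forall_inP/(_ w wW)/implyP := forall_inP Wc v vW; apply.
  by apply: contraNneq wv => ->.
have [s sF s_max] := exists_largest F0.
have ltD : #|F :\ s| < n by rewrite (cardsD1 s) sF in ltFn.
apply: (@contractible_setD1 _ _ (inr s : mixed)); first by rewrite inE.
  rewrite largest_sphere // (setIidPr (FW s sF)).
  have /andP[s0 sc] := valP s; apply: IHn => //.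
    by apply: leq_ltn_trans ltD; apply/subset_leq_card/subsetP => t /setIdP[].
  by move=> t /setIdP[].
by rewrite mixed_setD1r; apply: IHn => // t /setD1P[_]; apply: FW.
Qed.

Lemma deforms_remove_simplices F :
  deforms (mixed_set setT F) (mixed_set setT set0).
Proof.
have [n] := ubnP #|F|; elim: n F => // n IHn F ltFn.
have [->|F0] := eqVneq F set0; first exact: deforms_refl.
have [s sF s_max] := exists_largest F0.
apply: (deforms_trans (B := mixed_set setT (F :\ s))).
  rewrite -mixed_setD1r; apply: deforms_remove; first by rewrite inE.
  rewrite largest_sphere // setTI; have /andP[s0 sc] := valP s.
  by apply: contractible_faces => // t /setIdP[].
by apply: IHn; rewrite (cardsD1 s) sF in ltFn.
Qed.

(** * Putting the vertices back *)

Lemma simplex_setU1 s (w : G) : (forall v, v \in val s -> adj v w) ->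
  exists t : simplex G, val t = w |: val s.
Proof.
move=> sw; suff tP : (w |: val s != set0) && complete_set (w |: val s).
  by exists (exist _ (w |: val s) tP).
apply/andP; split; first by apply/set0Pn; exists w; rewrite setU11.
apply/forall_inP=> x /setU1P xs; apply/forall_inP=> y /setU1P ys.
apply/implyP; case: xs ys => [->|xs] [->|ys] xy.
- by rewrite eqxx in xy.
- by rewrite adj_sym sw.
- exact: sw.
- exact: (simplex_adj xs).
Qed.

Lemma contractible_cofaces s V :
  (forall v w, v \in val s -> w \in V -> adj v w) ->
  contractible_set (mixed_set V [set t : simplex G | val s \subset val t]).
Proof.
have [n] := ubnP #|V|; elim: n s V => // n IHn s V ltVn sV.
have [->|[w wV]] := set_0Vmem V.
  (* Every other coface of [s] contains [s] properly, so [s] is an apex. *)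
  apply: (contractible_cone (x := inr s : mixed)); first by rewrite !inE.
  case=> [v|t]; rewrite !inE //= => st ts.
  by rewrite /refinement_adj st andbT; apply: contraNneq ts => ->.
have ltD : #|V :\ w| < n by rewrite (cardsD1 w) wV in ltVn.
apply: (@contractible_setD1 _ _ (inl w : mixed)); first by rewrite inE.
  (* The sphere of [w] is made of the cofaces of [u] and the neighbours of [w] in [V]. These lie in
     the link of [u], and [w] is not among them, so the induction applies. *)
  have [u uE] : exists u : simplex G, val u = w |: val s.
    by apply: simplex_setU1 => v vs; apply: sV vs wV.
  rewrite mixed_setI_nbhdl.
  have -> : [set t in [set t : simplex G | val s \subset val t] | w \in val t] =
            [set t : simplex G | val u \subset val t].
    by apply/setP=> t; rewrite !inE uE subUset sub1set andbC.
  apply: IHn => [|v x].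
    apply: leq_ltn_trans ltD; apply/subset_leq_card/subsetP => x.
    rewrite !inE => /andP[-> wx]; rewrite andbT.
    by apply: contraTneq wx => ->; rewrite adj_irr.
  rewrite uE !inE => /predU1P[->|vs] /andP[xV wx //].
  exact: sV vs xV.
by rewrite mixed_setD1l; apply: IHn => // v x vs /setD1P[_ xV]; apply: sV vs xV.
Qed.

(** The removal of the vertices is read backwards, so that the steps start from the refinement. *)
Lemma deforms_add_vertices V :
  deforms (mixed_set set0 setT) (mixed_set V setT).
Proof.
have [n] := ubnP #|V|; elim: n V => // n IHn V ltVn.
have [->|[v vV]] := set_0Vmem V; first exact: deforms_refl.
apply: (deforms_trans (B := mixed_set (V :\ v) setT)).
  by apply: IHn; rewrite (cardsD1 v) vV in ltVn.
rewrite -mixed_setD1l; apply: deforms_add; first by rewrite inE.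
(* With [v] viewed as a simplex, the simplices containing [v] become its cofaces. *)
have sP : ([set v] != set0) && complete_set [set v].
  apply/andP; split; first by apply/set0Pn; exists v; rewrite set11.
  by apply/forall_inP=> x /set1P->; apply/forall_inP=> y /set1P->; rewrite eqxx.
pose s : simplex G := exist _ [set v] sP.
rewrite mixed_setI_nbhdl.
have -> : [set t : simplex G in setT | v \in val t] =
          [set t : simplex G | val s \subset val t].
  by apply/setP=> t; rewrite !inE sub1set.
by apply: contractible_cofaces => x w /set1P->; rewrite !inE => /andP[].
Qed.

Lemma represents_refinement :
  @represents mixed (refinement G) (mixed_set set0 setT).
Proof.
exists (inr : refinement G -> mixed); split=> // [x y [] //|].
apply/setP=> -[v|s]; rewrite !inE; apply/imsetP; last by exists s.
by case.
Qed.

Lemma represents_vertices : @represents mixed G (mixed_set setT set0).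
Proof.
exists (inl : G -> mixed); split=> // [x y [] //|].
apply/setP=> -[v|s]; rewrite !inE; apply/imsetP; first by exists v.
by case.
Qed.

End Mixed.

Theorem proposition21 (G : sgraph) : homotopic (refinement G) G.
Proof.
have deform : deforms (@mixed_set G set0 setT) (mixed_set setT set0).
  apply: (deforms_trans (B := mixed_set setT setT)).
    exact: deforms_add_vertices.
  exact: deforms_remove_simplices.
have [K stepsK rK] := deform _ (represents_refinement G).
by exists K => //; apply: represents_isomorphic rK (represents_vertices G).
Qed.
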